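(* In the setting of the context, let $1\le d\le m$, let $Z\in\mathbb R^{m\times d}$ satisfy $Z^TZ=I_d$, and let $c\in\mathbb R$. Define $$R_Z=(T-cI)Z,\qquad K_Z=Z^TGZ,\qquad W_Z=(I-ZZ^T)GZ .$$ Then $$(T-cI)W_Z=\mathcal EZ+GR_Z-R_ZK_Z .$$ Choose an integer $1\le t\le\operatorname{rank}(W_Z)$ and take $t$ leading singular triplets of $W_Z$, written as $$W_ZP_W=Q_W\Sigma_W,\qquad Q_W^TQ_W=P_W^TP_W=I_t,$$ where $Q_W\in\mathbb R^{m\times t}$, $P_W\in\mathbb R^{d\times t}$, and $\Sigma_W\in\mathbb R^{t\times t}$ is diagonal with positive entries. Set $$\varepsilon_Z=\left\|\left[\,R_Z\quad(\mathcal EZ+GR_Z-R_ZK_Z)P_W\Sigma_W^{-1}\right]\right\|_2 .$$ Then $T$ has at least $d+t$ eigenvalues, counted with multiplicity, in $[c-\varepsilon_Z,\,c+\varepsilon_Z]$. Moreover, $$(VZ)^T(VQ_W)=P_W\Sigma_W .$$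
   Context: $A=A^T\in\mathbb R^{n\times n}$; $k\ge1$, positive block sizes $r_1,\dots,r_k$, $m=\sum_ir_i$; $V=[V_1\ \cdots\ V_k]\in\mathbb R^{n\times m}$ with $V_i^TV_i=I_{r_i}$ is the (blockwise normalized, not globally orthonormal) computed block Lanczos basis; $T=T^T\in\mathbb R^{m\times m}$ is the block tridiagonal matrix of the computed recurrence $AV=VT+WHE_k^T+F$, where $W\in\mathbb R^{n\times s}$, $W^TW=I_s$, $0\le s\le r_k$, $H\in\mathbb R^{s\times r_k}$, $F\in\mathbb R^{n\times m}$, and $E_k\in\mathbb R^{m\times r_k}$ is the canonical injection into the last block. Define $$\mathcal R=AV-VT,\qquad G=V^TV,\qquad \mathcal E=TG-GT .$$ $\|\cdot\|_2$ is the spectral norm. *)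

(* Defs.v *)
From HB Require Import structures.
From mathcomp Require Import all_boot all_order all_algebra.
From mathcomp Require Import all_classical reals.

Set Implicit Arguments.
Unset Strict Implicit.
Unset Printing Implicit Defensive.
Import Order.TTheory GRing.Theory Num.Theory.

Local Open Scope classical_set_scope.
Local Open Scope ring_scope.

Definition norm2 (R : realType) (n : nat) (x : 'cV[R]_n) : R :=
  Num.sqrt (\sum_(i < n) x i 0 ^+ 2).

(* The library norm on matrices is the max-entry norm, hence this definition.
   The unit ball (not the sphere) keeps the set nonempty when q = 0. *)
Definition spectral_norm (R : realType) (p q : nat) (A : 'M[R]_(p, q)) : R :=
  sup [set norm2 (A *m x) | x in [set x : 'cV[R]_q | norm2 x <= 1]].

Definition orthonormal_cols (R : realType) (p q : nat) (Q : 'M[R]_(p, q)) :=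
  Q^T *m Q = 1%:M.

(* For p = \rank B; any other p makes this false. *)
Definition compact_svd (R : realType) (m d p : nat) (B : 'M[R]_(m, d))
    (Q : 'M[R]_(m, p)) (sigma : 'rV[R]_p) (P : 'M[R]_(d, p)) : Prop :=
  [/\ orthonormal_cols Q, orthonormal_cols P,
      forall i, 0 < sigma 0 i & B = Q *m diag_mx sigma *m P^T].

(* The t triplets are completed by q further ones, none of which has a larger
   singular value, to a compact singular value decomposition of B.  The t
   triplets may be listed in any order. *)
Definition leading_singular_triplets (R : realType) (m d t : nat)
    (B : 'M[R]_(m, d)) (Q : 'M[R]_(m, t)) (sigma : 'rV[R]_t)
    (P : 'M[R]_(d, t)) : Prop :=
  exists (q : nat) (Q' : 'M[R]_(m, q)) (sigma' : 'rV[R]_q) (P' : 'M[R]_(d, q)),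
    compact_svd B (row_mx Q Q') (row_mx sigma sigma') (row_mx P P') /\
    forall i j, sigma' 0 j <= sigma 0 i.

(* s lists the eigenvalues of T repeated according to algebraic multiplicity;
   it is unique up to permutation. *)
Definition eigenvalue_list (R : realType) (m : nat) (T : 'M[R]_m)
    (s : seq R) : Prop :=
  char_poly T = \prod_(x <- s) ('X - x%:P).

Definition block_tridiagonal (R : realType) (k : nat) (r : 'I_k -> nat)
    (T : 'M[R]_(\sum_i r i)) : Prop :=
  forall i j : 'I_k, (i.+1 < j)%N || (j.+1 < i)%N -> submxblock T i j = 0.

(* Column block j of the identity. *)
Definition block_injection (R : realType) (k : nat) (r : 'I_k -> nat)
    (j : 'I_k) : 'M[R]_(\sum_i r i, r j) :=
  submxrow (1%:M : 'M[R]_(\sum_i r i)) j.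

(* Main.v *)
(* The columns of WZ are orthogonal to those of Z, hence so are those of
   QW = WZ PW SW^-1, and U = [Z QW] has d + t orthonormal columns.  The identity
   for (T - c) WZ says that eps is the spectral norm of (T - c) U.  If fewer than
   d + t eigenvalues of T were within eps of c, some nonzero U x would have no
   component along the corresponding eigenvectors, and T - c would stretch it by
   a factor larger than eps.  The orthonormal eigenbasis comes from the complex
   spectral theorem; a real matrix has the same norm on complex vectors, as it
   acts separately on real and imaginary parts. *)
Require Import Defs.
From mathcomp Require Import all_boot all_order all_algebra.
From mathcomp Require Import all_classical reals.
From mathcomp Require Import complex.
Import Order.TTheory GRing.Theory Num.Theory.
Local Open Scope ring_scope.

(** * Euclidean and spectral norms of real matrices *)

Lemma norm2_ge0 {R : realType} {n : nat} (x : 'cV[R]_n) : 0 <= norm2 x.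
Proof. exact: sqrtr_ge0. Qed.

Lemma sqr_norm2 {R : realType} {n : nat} (x : 'cV[R]_n) :
  norm2 x ^+ 2 = \sum_(i < n) x i 0 ^+ 2.
Proof. by rewrite sqr_sqrtr // sumr_ge0 // => i _; apply: sqr_ge0. Qed.

Lemma norm2_eq0 {R : realType} {n : nat} (x : 'cV[R]_n) :
  norm2 x = 0 -> x = 0.
Proof.
move=> x0; apply/colP => i; rewrite mxE.
have /eqP : \sum_(i < n) x i 0 ^+ 2 = 0 by rewrite -sqr_norm2 x0 expr0n.
rewrite psumr_eq0 => [/allP/(_ i)|j _]; last exact: sqr_ge0.
by rewrite mem_index_enum sqrf_eq0 => /(_ isT)/eqP.
Qed.

Lemma norm2Z {R : realType} {n : nat} (a : R) (x : 'cV[R]_n) :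
  norm2 (a *: x) = `|a| * norm2 x.
Proof.
rewrite /norm2 -sqrtr_sqr -sqrtrM ?sqr_ge0 //; congr Num.sqrt.
by rewrite mulr_sumr; apply: eq_bigr => i _; rewrite mxE exprMn.
Qed.

Lemma ler_coord_norm2 {R : realType} {n : nat} (x : 'cV[R]_n) (i : 'I_n) :
  `|x i 0| <= norm2 x.
Proof.
rewrite -ler_sqr ?nnegrE ?norm2_ge0 // sqr_norm2 real_normK ?num_real //.
by rewrite (bigD1 i) //= lerDl sumr_ge0 // => j _; apply: sqr_ge0.
Qed.

(** Coordinates of [x] are at most 1 in absolute value, so row [i] contributes at most its absolute
    row sum. Boundedness is what makes the [sup] in [spectral_norm] an upper bound. *)
Lemma norm2_mulmx_bounded {R : realType} {p q : nat} (A : 'M[R]_(p, q)) :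
  has_ubound
    [set norm2 (A *m x) | x in [set x : 'cV[R]_q | norm2 x <= 1]]%classic.
Proof.
exists (Num.sqrt (\sum_i (\sum_j `|A i j|) ^+ 2)) => _ [x /= x1 <-].
rewrite ler_sqrt ?sumr_ge0 // => [|i _]; last exact: sqr_ge0.
apply: ler_sum => i _; rewrite -real_normK ?num_real //.
rewrite ler_sqr ?nnegrE ?sumr_ge0 // mxE.
apply: le_trans (ler_norm_sum _ _ _) _; apply: ler_sum => j _.
by rewrite normrM ler_piMr // (le_trans (ler_coord_norm2 x j)).
Qed.

Lemma norm2_mulmx_le {R : realType} {p q : nat} (A : 'M[R]_(p, q)) x :
  norm2 (A *m x) <= spectral_norm A * norm2 x.
Proof.
have [/norm2_eq0->|x0] := eqVneq (norm2 x) 0.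
  (* Writing the zero vectors as [0 *: 0] gives their norms by homogeneity. *)
  rewrite mulmx0 -(scale0r (0 : 'cV_p)) -(scale0r (0 : 'cV_q)) !norm2Z.
  by rewrite normr0 !mul0r mulr0.
have x_gt0 : 0 < norm2 x by rewrite lt_def x0 norm2_ge0.
rewrite -ler_pdivrMr // mulrC -[_^-1]ger0_norm ?invr_ge0 ?norm2_ge0 //.
rewrite -norm2Z scalemxAr; apply: ub_le_sup (norm2_mulmx_bounded A) _ _.
exists ((norm2 x)^-1 *: x) => //=.
by rewrite norm2Z ger0_norm ?invr_ge0 ?norm2_ge0 // mulVf.
Qed.

Lemma spectral_norm_ge0 {R : realType} {p q : nat} (A : 'M[R]_(p, q)) :
  0 <= spectral_norm A.
Proof.
apply: le_trans (norm2_ge0 (A *m 0)) _.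
apply: ub_le_sup (norm2_mulmx_bounded A) _ _; exists 0 => //=.
by rewrite -(scale0r (0 : 'cV_q)) norm2Z normr0 mul0r ler01.
Qed.

(** * Eigenvalue counts for complex normal matrices *)

Local Open Scope sesquilinear_scope.

(** Kept squared, so that it is [x^* x] and no root is taken in [C]. *)
Definition sqnorm {C : numClosedFieldType} {n : nat} (x : 'cV[C]_n) : C :=
  \sum_(i < n) `|x i 0| ^+ 2.

Lemma sqnormE {C : numClosedFieldType} {n : nat} (x : 'cV[C]_n) :
  sqnorm x = (x^t* *m x) 0 0.
Proof. by rewrite mxE; apply: eq_bigr => i _; rewrite !mxE normCKC. Qed.

Lemma sqnorm_eq0 {C : numClosedFieldType} {n : nat} (x : 'cV[C]_n) :
  sqnorm x = 0 -> x = 0.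
Proof.
move=> /eqP; rewrite psumr_eq0 => [/allP x0|i _]; last by rewrite exprn_ge0.
apply/colP => i; have := x0 i (mem_index_enum _).
by rewrite sqrf_eq0 normr_eq0 mxE => /eqP.
Qed.

Lemma sqnorm_isometry {C : numClosedFieldType} {m n : nat} (U : 'M[C]_(m, n)) x :
  U^t* *m U = 1%:M -> sqnorm (U *m x) = sqnorm x.
Proof.
move=> UU; rewrite !sqnormE trmx_mul map_mxM -mulmxA (mulmxA _ U) UU.
by rewrite mul1mx.
Qed.

Lemma mulmx_kernel_ex {F : fieldType} {m n : nat} (M : 'M[F]_(m, n)) :
  (m < n)%N -> exists2 x : 'cV_n, x != 0 & M *m x = 0.
Proof.
move=> mn; have : kermx M^T != 0.
  rewrite -mxrank_eq0 mxrank_ker mxrank_tr subn_eq0 -ltnNge.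
  exact: leq_ltn_trans (rank_leq_row M) mn.
case/rowV0Pn => v /sub_kermxP vM v0.
exists v^T; first by rewrite -trmx_eq0 trmxK.
by apply: trmx_inj; rewrite trmx_mul trmxK vM trmx0.
Qed.

Lemma normal_spectrum_count {C : numClosedFieldType} {m p : nat}
    (A : 'M[C]_m) (U : 'M[C]_(m, p)) (c e : C) :
  A \is normalmx -> 0 <= e -> U^t* *m U = 1%:M ->
  (forall x, sqnorm ((A - c%:M) *m U *m x) <= e ^+ 2 * sqnorm x) ->
  (p <= #|[set i | (`|spectral_diag A 0 i - c| <= e)%R]|)%N.
Proof.
move=> /orthomx_spectralP; set P := spectralmx A; set a := spectral_diag A.
move=> defA e0 UU Ule; set S := [set _ | _]; rewrite leqNgt; apply/negP => ltSp.
have Pu : P \is unitarymx by apply: spectral_unitarymx.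
have Punit : P \in unitmx by apply: unitarymx_unit.
have PP : P^t* *m P = 1%:M by rewrite -invmx_unitary // mulVmx.
(* Vanishing of the eigenbasis coordinates indexed by [S] amounts to fewer than [p] linear equations
   on the [p] entries of [x]. *)
have [x xN0 Mx0] :=
  mulmx_kernel_ex (rowsub (@enum_val _ (mem S)) (P *m U)) ltSp.
pose y := P *m U *m x.
have yS i : i \in S -> y i 0 = 0.
  move=> iS; have /matrixP/(_ (enum_rank_in iS i) 0) := Mx0.
  by rewrite mul_rowsub_mx !mxE enum_rankK_in.
have normy : sqnorm y = sqnorm x.
  by rewrite /y -mulmxA !sqnorm_isometry.
have: e ^+ 2 * sqnorm y >= \sum_i `|a 0 i - c| ^+ 2 * `|y i 0| ^+ 2.
  rewrite normy; apply: le_trans (Ule x).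
  (* Equality holds: [P] is unitary and turns [A - c] into the diagonal matrix of the
     [a 0 i - c]. *)
  rewrite -(sqnorm_isometry P) // le_eqVlt; apply/orP; left; apply/eqP.
  rewrite !mulmxA mulmxBr {1}defA !mulmxA mulmxV // mul1mx.
  rewrite mul_mx_scalar -mul_scalar_mx -mulmxBl -!mulmxA (mulmxA P).
  apply: eq_bigr => i _; rewrite mulmxBl mxE mul_diag_mx mul_scalar_mx !mxE.
  by rewrite -mulrBl normrM exprMn.
rewrite /sqnorm mulr_sumr -subr_ge0 -sumrB -oppr_le0 -sumrN.
under eq_bigr => i _ do rewrite opprB -mulrBl.
(* Each term is nonnegative, and the factor before [y i 0] is positive outside [S]. The sum being at
   most 0, all of [y] vanishes, hence so does [x]. *)
have ge0 i : 0 <= (`|a 0 i - c| ^+ 2 - e ^+ 2) * `|y i 0| ^+ 2.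
  have [/yS->|] := boolP (i \in S); first by rewrite normr0 expr0n mulr0.
  rewrite inE -real_ltNge ?ger0_real // => lte.
  by rewrite mulr_ge0 ?exprn_ge0 // subr_ge0 lerXn2r ?nnegrE // ltW.
move=> sum_le0; have /eqP :
    \sum_i (`|a 0 i - c| ^+ 2 - e ^+ 2) * `|y i 0| ^+ 2 = 0.
  by apply/eqP; rewrite eq_le sum_le0 sumr_ge0.
rewrite psumr_eq0 // => /allP y0; case/eqP: xN0; apply: sqnorm_eq0.
rewrite -normy /sqnorm big1 // => i _; have [/yS->|] := boolP (i \in S).
  by rewrite normr0 expr0n.
rewrite inE -real_ltNge ?ger0_real // => lte.
have := y0 i (mem_index_enum _); rewrite mulf_eq0 subr_eq0 => /orP[|/eqP//].
by rewrite eqrXn2 // gt_eqF.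
Qed.

(** Conjugation by [P] lifts to polynomial matrices, where the determinants of [P] and its inverse
    cancel. *)
Lemma char_poly_spectral {C : numClosedFieldType} {m : nat} (A : 'M[C]_m) :
  A \is normalmx -> char_poly A = \prod_i ('X - (spectral_diag A 0 i)%:P).
Proof.
move=> /orthomx_spectralP; set P := spectralmx A; set a := spectral_diag A.
move=> defA; have Punit : P \in unitmx := spectral_unit A.
transitivity (char_poly (diag_mx a)); last first.
  rewrite char_poly_trig ?diag_mx_is_trig //.
  by apply: eq_bigr => i _; rewrite mxE eqxx mulr1n.
have PXP : map_mx polyC (invmx P) *m map_mx polyC P = 1%:M.
  by rewrite -map_mxM mulVmx // map_mx1.
rewrite {1}defA /char_poly /char_poly_mx.
suff -> : 'X%:M - map_mx polyC (invmx P *m diag_mx a *m P) =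
    map_mx polyC (invmx P) *m ('X%:M - map_mx polyC (diag_mx a))
      *m map_mx polyC P.
  by rewrite !det_mulmx mulrAC -det_mulmx PXP det1 mul1r.
rewrite mulmxBr mulmxBl !map_mxM; congr (_ - _).
by rewrite mul_mx_scalar -scalemxAl PXP scalemx1.
Qed.

(** * Transfer from complex to real matrices *)

Section RealMatrices.
Variable R : realType.
Notation toC := (real_complex R).
Local Notation MtoC := (map_mx toC).

Lemma sqnorm_complex {n : nat} (x : 'cV[R[i]]_n) :
  sqnorm x =
    toC (norm2 (map_mx (@complex.Re R) x) ^+ 2 + norm2 (map_mx (@complex.Im R) x) ^+ 2).
Proof.
rewrite !sqr_norm2 -big_split rmorph_sum.
by apply: eq_bigr => i _; rewrite -add_Re2_Im2 !mxE.
Qed.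

Lemma map_Re_mulmx {m n : nat} (M : 'M[R]_(m, n)) (x : 'cV[R[i]]_n) :
  map_mx (@complex.Re R) (MtoC M *m x) = M *m map_mx (@complex.Re R) x.
Proof.
apply/colP => i; rewrite !mxE.
(* [complex.Re] is additive as a map on [Rcomplex R]. *)
rewrite (raddf_sum (@complex.Re R : {additive Rcomplex R -> R})).
apply: eq_bigr => j _; rewrite !mxE; case: (x j 0) => a b /=.
by rewrite mul0r subr0.
Qed.

Lemma map_Im_mulmx {m n : nat} (M : 'M[R]_(m, n)) (x : 'cV[R[i]]_n) :
  map_mx (@complex.Im R) (MtoC M *m x) = M *m map_mx (@complex.Im R) x.
Proof.
apply/colP => i; rewrite !mxE.
rewrite (raddf_sum (@complex.Im R : {additive Rcomplex R -> R})).
apply: eq_bigr => j _; rewrite !mxE; case: (x j 0) => a b /=.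
by rewrite mul0r addr0.
Qed.

Lemma sqnorm_complex_mulmx_le {m n : nat} (M : 'M[R]_(m, n)) (x : 'cV[R[i]]_n) :
  sqnorm (MtoC M *m x) <= toC (spectral_norm M) ^+ 2 * sqnorm x.
Proof.
rewrite !sqnorm_complex map_Re_mulmx map_Im_mulmx -rmorphXn -rmorphM /= lecR.
by rewrite mulrDr -!exprMn lerD // lerXn2r ?nnegrE ?norm2_mulmx_le
  ?mulr_ge0 ?spectral_norm_ge0 ?norm2_ge0.
Qed.

Lemma conj_map_real {m n : nat} (M : 'M[R]_(m, n)) :
  (MtoC M)^t* = MtoC M^T.
Proof. by apply/matrixP => i j; rewrite !mxE conj_Creal // complex_real. Qed.

Lemma symmetric_eigenvalue_count {m p : nat} (T : 'M[R]_m) (U : 'M[R]_(m, p))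
    (c : R) :
  T = T^T -> orthonormal_cols U ->
  let eps := spectral_norm ((T - c%:M) *m U) in
  exists2 evs : seq R, eigenvalue_list T evs &
    (p <= count (fun x : R => (x \in `[c - eps, c + eps])%R) evs)%N.
Proof.
move=> Tsym UU eps; have Therm : MtoC T \is hermsymmx.
  by apply/is_hermitianmxP; rewrite expr0 scale1r conj_map_real -Tsym.
have Tnormal := hermitian_normalmx Therm.
pose a := spectral_diag (MtoC T).
have /mxOverP areal := hermitian_spectral_diag_real Therm.
(* The eigenvalues are real, so taking real parts loses nothing; the factorization descends because
   the embedding of real polynomials is injective. *)
exists [seq complex.Re (a 0 i) | i <- enum 'I_m].
  apply: (map_poly_inj toC); rewrite map_char_poly char_poly_spectral //.
  rewrite big_map big_enum rmorph_prod; apply: eq_bigr => i _.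
  by rewrite rmorphB /= map_polyX map_polyC /= RRe_real.
have UUC : (MtoC U)^t* *m MtoC U = 1%:M.
  by rewrite conj_map_real -map_mxM UU map_mx1.
have := @normal_spectrum_count _ _ _ (MtoC T) (MtoC U)
  (toC c) (toC eps) Tnormal.
rewrite ler0c spectral_norm_ge0 => /(_ isT UUC) H; apply: leq_trans (H _) _.
  move=> x; have := sqnorm_complex_mulmx_le ((T - c%:M) *m U) x.
  by rewrite map_mxM map_mxB map_scalar_mx.
(* Both counts become sums over ['I_m], compared term by term. *)
rewrite -sum1_card -sum1_count big_map big_enum_cond /=.
rewrite [leqLHS]big_mkcond [leqRHS]big_mkcond; apply: leq_sum => i _.
have ai : a 0 i = toC (complex.Re (a 0 i)) by rewrite [RHS]RRe_real.
rewrite inE -/a ai -rmorphB normc_def /= expr0n addr0 sqrtr_sqr lecR.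
by rewrite ler_distl in_itv.
Qed.
End RealMatrices.

(** * Singular triplets and the theorem *)

Lemma diag_mx_unit {F : fieldType} {n : nat} (d : 'rV[F]_n) :
  (forall i, d 0 i != 0) -> diag_mx d \in unitmx.
Proof.
move=> d0; rewrite unitmxE det_diag unitfE.
by apply/prodf_neq0 => i _; apply: d0.
Qed.

Lemma orthonormal_cols_row_mx {R : realType} {m d t : nat}
    (Z : 'M[R]_(m, d)) (Q : 'M[R]_(m, t)) :
  orthonormal_cols (row_mx Z Q) <->
  [/\ orthonormal_cols Z, orthonormal_cols Q & Z^T *m Q = 0].
Proof.
rewrite /orthonormal_cols tr_row_mx mul_col_row (@scalar_mx_block _ d t).
split=> [/eq_block_mx[-> -> _ ->] // | [-> -> ZQ]].
by rewrite ZQ -[Q^T *m Z]trmxK trmx_mul trmxK ZQ trmx0.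
Qed.

(** Transposing the full decomposition, [Q'^T *m Q = 0] kills the complementary triplets. *)
Lemma leading_singular_triplets_tr {R : realType} {m d t : nat}
    (B : 'M[R]_(m, d)) (Q : 'M[R]_(m, t)) (sigma : 'rV[R]_t) (P : 'M[R]_(d, t)) :
  leading_singular_triplets B Q sigma P -> B^T *m Q = P *m diag_mx sigma.
Proof.
case=> [q [Q' [sigma' [P' [[/orthonormal_cols_row_mx[QQ _ QQ'] _ _ ->] _]]]]].
have Q'Q : Q'^T *m Q = 0 by rewrite -[LHS]trmxK trmx_mul trmxK QQ' trmx0.
rewrite !trmx_mul trmxK tr_diag_mx tr_row_mx -!mulmxA mul_col_mx QQ Q'Q.
rewrite diag_mx_row mul_block_col !mulmx0 mul0mx !addr0 mulmx1.
by rewrite mul_row_col mulmx0 addr0.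
Qed.

(* MathComp world; there are k.+1 blocks, indexed by 'I_k.+1. *)
Theorem theorem8 (R : realType) (n k : nat) (r : 'I_k.+1 -> nat)
    (A : 'M[R]_n) (V : 'M[R]_(n, \sum_i r i)) (T : 'M[R]_(\sum_i r i))
    (s : nat) (W : 'M[R]_(n, s)) (H : 'M[R]_(s, r ord_max))
    (F : 'M[R]_(n, \sum_i r i))
    (A_sym : A = A^T)
    (r_gt0 : forall i, (0 < r i)%N)
    (V_blocks : forall i, orthonormal_cols (submxrow V i))
    (T_sym : T = T^T)
    (T_tridiag : block_tridiagonal T)
    (s_le : (s <= r ord_max)%N)
    (W_orth : orthonormal_cols W)
    (recurrence :
       A *m V = V *m T + W *m H *m (block_injection R r ord_max)^T + F)
    (d : nat) (d_gt0 : (1 <= d)%N) (d_le : (d <= \sum_i r i)%N)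
    (Z : 'M[R]_(\sum_i r i, d)) (Z_orth : orthonormal_cols Z) (c : R) :
  let G := V^T *m V in
  let E : 'M[R]_(\sum_i r i) := T *m G - G *m T in
  let RZ := (T - c%:M) *m Z in
  let KZ := Z^T *m G *m Z in
  let WZ := (1%:M - Z *m Z^T) *m G *m Z in
  (T - c%:M) *m WZ = E *m Z + G *m RZ - RZ *m KZ /\
  forall (t : nat) (QW : 'M[R]_(\sum_i r i, t)) (PW : 'M[R]_(d, t))
      (sigma : 'rV[R]_t),
    (1 <= t)%N -> (t <= \rank WZ)%N ->
    let SW := diag_mx sigma in
    WZ *m PW = QW *m SW ->
    orthonormal_cols QW -> orthonormal_cols PW ->
    (forall i, 0 < sigma 0 i) ->
    leading_singular_triplets WZ QW sigma PW ->
    let eps := spectral_norm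
      (row_mx RZ ((E *m Z + G *m RZ - RZ *m KZ) *m PW *m invmx SW)) in
    (exists2 evs : seq R, eigenvalue_list T evs &
       (d + t <= count (fun x : R => (x \in `[c - eps, c + eps])%R) evs)%N) /\
    (V *m Z)^T *m (V *m QW) = PW *m SW.
Proof.
move=> G E RZ KZ WZ.
have WZE : (T - c%:M) *m WZ = E *m Z + G *m RZ - RZ *m KZ.
  (* Since [c%:M] commutes with [G], the commutator of [T - c%:M] with [G] is still [E]. *)
  have SGZ : (T - c%:M) *m G *m Z = E *m Z + G *m RZ.
    rewrite /RZ /E mulmxA -mulmxDl mulmxBr mulmxBl mul_mx_scalar mul_scalar_mx.
    by rewrite addrA subrK.
  rewrite -SGZ /WZ /RZ /KZ; move: (T - c%:M) => S.
  by rewrite !mulmxBl mul1mx mulmxBr !mulmxA.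
split=> // t QW PW sigma _ _ SW WPQ QQ PP sigma_gt0 lead eps.
have SWu : SW \in unitmx by apply: diag_mx_unit => i; rewrite gt_eqF.
have QWE : QW = WZ *m PW *m invmx SW by rewrite WPQ mulmxK.
(* The projector in [WZ] is annihilated by [Z^T]. *)
have ZQ : Z^T *m QW = 0.
  rewrite QWE /WZ !mulmxA mulmxBr mulmx1 mulmxA Z_orth mul1mx subrr.
  by rewrite !mul0mx.
split.
  have UU : orthonormal_cols (row_mx Z QW) by apply/orthonormal_cols_row_mx.
  have := symmetric_eigenvalue_count _ _ _ c T_sym UU.
  (* Expanding [QW] in the second block identifies the norm of [(T - c%:M) *m [Z QW]] with [eps]. *)
  by rewrite mul_mx_row {1}QWE 2!(mulmxA (T - c%:M)) WZE.
(* The right side is [WZ^T *m QW], in which the projector fixes [QW] because [Z^T *m QW = 0]. *)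
rewrite -(leading_singular_triplets_tr _ _ _ _ lead) /WZ /G !trmx_mul !trmxK.
rewrite linearB /= trmx1 trmx_mul trmxK -!mulmxA mulmxBl mul1mx -mulmxA ZQ.
by rewrite mulmx0 subr0.
Qed.
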